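(* Let $m$ and $r$ be integers with $r\neq 0$ and $m$ odd. There is no $Q$-polynomial association scheme with Krein array $$\left\{m,\ m-1,\ \frac{m(r^2-1)}{r^2},\ m-r^2+1;\ 1,\ \frac{m}{r^2},\ r^2-1,\ m\right\}.$$
   Context: A (symmetric) association scheme with $D$ classes is a pair $(X,\{R_i\}_{i=0}^D)$ where $X$ is a finite set and $R_0,\dots,R_D$ are non-empty subsets of $X\times X$ whose adjacency matrices $A_0,\dots,A_D$ satisfy: $A_0=I$, $\sum_i A_i=J$, $A_i^\top=A_i$, and $A_iA_j=\sum_k p_{ij}^kA_k$ for nonnegative integers $p_{ij}^k$. The real span of the $A_i$ has a basis of primitive idempotents $E_0=\frac{1}{|X|}J,E_1,\dots,E_D$, closed under entrywise product $\circ$; the Krein parameters $q_{ij}^k$ are defined by $E_i\circ E_j=\frac1{|X|}\sum_k q_{ij}^kE_k$. An ordering $E_1,\dots,E_D$ is $Q$-polynomial if $(q_{1j}^k)_{k,j=0}^D$ is tridiagonal with all superdiagonal and subdiagonal entries nonzero; then with $b_i^*=q_{1,i+1}^i$, $c_i^*=q_{1,i-1}^i$, the Krein array is $\{b_0^*,\dots,b_{D-1}^*;c_1^*,\dots,c_D^*\}$. A $Q$-polynomial association scheme with a given Krein array is one admitting a $Q$-polynomial ordering with that Krein array. *)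

(* Defs.v *)
From mathcomp Require Import all_boot all_order all_algebra.
From mathcomp Require Import reals.
Set Implicit Arguments.
Unset Strict Implicit.
Unset Printing Implicit Defensive.
Import Order.TTheory GRing.Theory Num.Theory.
Local Open Scope ring_scope.

(* Rows and columns are indexed by X through the enumeration of X. *)
Definition adjmx (R : realType) (X : finType) (S : {set X * X}) : 'M[R]_#|X| :=
  \matrix_(x, y) ((enum_val x, enum_val y) \in S)%:R.

Definition assoc_scheme (R : realType) (X : finType) (D : nat)
    (S : 'I_D.+1 -> {set X * X}) : Prop :=
  let A i := adjmx R (S i) in
  [/\ forall i, S i != set0,
      A ord0 = 1%:M,
      \sum_i A i = const_mx 1,
      forall i, (A i)^T = A i
    & exists p : 'I_D.+1 -> 'I_D.+1 -> 'I_D.+1 -> nat,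
        forall i j, A i *m A j = \sum_k (p i j k)%:R *: A k].

Definition bose_mesner (R : realType) (X : finType) (D : nat)
    (S : 'I_D.+1 -> {set X * X}) : {vspace 'M[R]_#|X|} :=
  <<[seq adjmx R (S i) | i <- enum 'I_D.+1]>>%VS.

Definition idempotent_in (R : realType) (n : nat) (V : {vspace 'M[R]_n})
    (F : 'M[R]_n) : Prop :=
  F \in V /\ F *m F = F.

Definition primitive_idempotent (R : realType) (n : nat)
    (V : {vspace 'M[R]_n}) (F : 'M[R]_n) : Prop :=
  [/\ idempotent_in V F,
      F != 0
    & forall G H, idempotent_in V G -> idempotent_in V H ->
        G *m H = 0 -> H *m G = 0 -> F = G + H -> G = 0 \/ H = 0].

Definition primitive_idempotent_basis (R : realType) (X : finType) (D : nat)
    (S : 'I_D.+1 -> {set X * X}) (E : 'I_D.+1 -> 'M[R]_#|X|) : Prop :=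
  [/\ E ord0 = #|X|%:R^-1 *: const_mx 1,
      forall i, primitive_idempotent (bose_mesner R S) (E i)
    & basis_of (bose_mesner R S) [seq E i | i <- enum 'I_D.+1]].

Definition hadamard (R : realType) (n : nat) (M N : 'M[R]_n) : 'M[R]_n :=
  map2_mx *%R M N.

(* q i j k stands for q_{ij}^k; it is determined by the equation below when E
   is a basis. *)
Definition krein_parameters (R : realType) (X : finType) (D : nat)
    (E : 'I_D.+1 -> 'M[R]_#|X|)
    (q : 'I_D.+1 -> 'I_D.+1 -> 'I_D.+1 -> R) : Prop :=
  forall i j, hadamard (E i) (E j) = #|X|%:R^-1 *: \sum_k q i j k *: E k.

(* Tridiagonal, with all superdiagonal and subdiagonal entries nonzero. *)
Definition irreducible_tridiagonal (R : realType) (n : nat) (M : 'M[R]_n) :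
    Prop :=
  forall k j : 'I_n,
    ((k.+1 < j)%N \/ (j.+1 < k)%N -> M k j = 0) /\
    (k.+1 = j :> nat \/ j.+1 = k :> nat -> M k j != 0).

(* The condition 0 < D makes inord 1 the index 1. *)
Definition Qpolynomial (R : realType) (D : nat)
    (q : 'I_D.+1 -> 'I_D.+1 -> 'I_D.+1 -> R) : Prop :=
  (0 < D)%N /\ irreducible_tridiagonal (\matrix_(k, j) q (inord 1) j k).

Definition krein_array (R : realType) (D : nat)
    (q : 'I_D.+1 -> 'I_D.+1 -> 'I_D.+1 -> R) : seq R * seq R :=
  ([seq q (inord 1) (inord i.+1) (inord i) | i <- iota 0 D],
   [seq q (inord 1) (inord i.-1) (inord i) | i <- iota 1 D]).

Definition Qpolynomial_scheme (R : realType) (X : finType) (D : nat)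
    (S : 'I_D.+1 -> {set X * X}) (bc : seq R * seq R) : Prop :=
  assoc_scheme R S /\
  exists (E : 'I_D.+1 -> 'M[R]_#|X|)
         (q : 'I_D.+1 -> 'I_D.+1 -> 'I_D.+1 -> R),
    [/\ primitive_idempotent_basis S E, krein_parameters E q,
        Qpolynomial q & krein_array q = bc].

(* Main.v *)
(* The row sums of (q_{1j}^k) equal m, so the diagonal Krein parameters
   q_{1i}^i vanish and c = (r/m) |X| E_1 takes only the values 0, 1, -1, r, -r:
   the points of X are unit vectors of R^m with inner products c/r, closed
   under x |-> -x.  Whenever q_{ij}^k = 0, the triple sums
   sum_w E_i(x,w) E_j(y,w) E_k(z,w) vanish for all x, y, z.  Applied to
   q_{11}^1, q_{12}^2 and q_{11}^4 this gives
     sum_w c_xw c_yw c_zw = 0,    sum_w c_xw^2 c_yw c_zw^2 = 0,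
     sum_w c_xw^2 c_yw c_zw = 2 ((r^2-1) r c_yz + m c_xy c_xz).
   There are x, y, z with c_yz = 0 and c_xy, c_xz = 1 or -1.  All terms of
   sum_w (c_xw^2 + c_xw) c_yw (c_zw^2 - c_zw) are divisible by 4, while the
   sum is 2 ((r^2-1) r c_xy - m c_xy c_xz), so that m is even. *)
Require Import Defs.
From mathcomp Require Import all_boot all_order all_algebra.
From mathcomp Require Import reals.
From mathcomp Require Import zify ring.
Set Implicit Arguments.
Unset Strict Implicit.
Unset Printing Implicit Defensive.
Import Order.TTheory GRing.Theory Num.Theory.
Local Open Scope ring_scope.

(** * Vanishing of triple sums *)

(* The squares of the sums over [t] add up to [a ^+ 3] times the sum assumed to
   vanish. *)
Lemma triple_sum_eq0 (R : realFieldType) (T : finType) (a : R)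
    (u v w : T -> T -> R) :
  (forall x y, \sum_z u z x * u z y = a * u x y) ->
  (forall x y, \sum_z v z x * v z y = a * v x y) ->
  (forall x y, \sum_z w z x * w z y = a * w x y) ->
  \sum_x \sum_y u x y * v x y * w x y = 0 ->
  forall x y z, \sum_t u x t * v y t * w z t = 0.
Proof.
move=> hu hv hw h0 x y z.
have sum0 : \sum_x \sum_y \sum_z (\sum_t u x t * v y t * w z t) ^+ 2 = 0.
  (* Expanding each square brings in a second summation index; summing over [x], [y], [z] first
     splits the result into three factors, which [hu], [hv] and [hw] evaluate. *)
  transitivity (\sum_s \sum_t (\sum_x u x s * u x t) *
      ((\sum_y v y s * v y t) * (\sum_z w z s * w z t))); last first.
    transitivity (a ^+ 3 * \sum_s \sum_t u s t * v s t * w s t).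
      rewrite mulr_sumr; apply: eq_bigr => s _; rewrite mulr_sumr.
      by apply: eq_bigr => t _; rewrite hu hv hw; ring.
    by rewrite h0 mulr0.
  under eq_bigr do under eq_bigr do under eq_bigr do
    rewrite expr2 mulr_suml.
  under eq_bigr do under eq_bigr do rewrite exchange_big.
  under eq_bigr do rewrite exchange_big.
  rewrite exchange_big; apply: eq_bigr => s _ /=.
  under eq_bigr do under eq_bigr do under eq_bigr do rewrite mulr_sumr.
  under eq_bigr do under eq_bigr do rewrite exchange_big.
  under eq_bigr do rewrite exchange_big.
  rewrite exchange_big; apply: eq_bigr => t _ /=.
  rewrite mulr_suml; apply: eq_bigr => x1 _.
  rewrite mulr_suml mulr_sumr; apply: eq_bigr => x2 _.
  by rewrite !mulr_sumr; apply: eq_bigr => x3 _; ring.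
have := sum0 => /eqP; rewrite psumr_eq0; last first.
  by move=> *; apply: sumr_ge0 => *; apply: sumr_ge0 => *; exact: sqr_ge0.
move=> /allP/(_ x (mem_index_enum _))/=.
rewrite psumr_eq0; last by move=> *; apply: sumr_ge0 => *; exact: sqr_ge0.
move=> /allP/(_ y (mem_index_enum _))/=.
rewrite psumr_eq0; last by move=> *; exact: sqr_ge0.
by move=> /allP/(_ z (mem_index_enum _))/=; rewrite sqrf_eq0 => /eqP.
Qed.

(** * The matrices [f i] as polynomials in [c], and the values of [c] *)

(* [f i] stands for the matrix #|T| E_i; [ks_k1] to [ks_k4] expand the entrywise
   products of E_1 with E_1, ..., E_4. *)
Record krein_system (R : realFieldType) (T : finType) (m r : R)
    (f : nat -> T -> T -> R) : Prop := KreinSystem {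
  ks_m0 : m != 0;
  ks_m1 : m - 1 != 0;
  ks_r0 : r != 0;
  ks_g1 : r ^+ 2 - 1 != 0;
  ks_gm : m - r ^+ 2 + 1 != 0;
  ks_f0 : forall x y, f 0%N x y = 1;
  ks_sym : forall i x y, f i x y = f i y x;
  ks_idem : forall i x y, \sum_z f i x z * f i z y = #|T|%:R * f i x y;
  ks_orth : forall i j, (i < 5)%N -> (j < 5)%N -> i != j ->
    forall x y, \sum_z f i x z * f j z y = 0;
  ks_sum : forall x y,
    f 0%N x y + f 1%N x y + f 2%N x y + f 3%N x y + f 4%N x y
      = #|T|%:R * (x == y)%:R;
  ks_diag : forall x, f 1%N x x = m;
  ks_k1 : forall x y, f 1%N x y * f 1%N x y = m + m / r ^+ 2 * f 2%N x y;
  ks_k2 : forall x y,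
    f 1%N x y * f 2%N x y = (m - 1) * f 1%N x y + (r ^+ 2 - 1) * f 3%N x y;
  ks_k3 : forall x y,
    f 1%N x y * f 3%N x y
      = m * (r ^+ 2 - 1) / r ^+ 2 * f 2%N x y + m * f 4%N x y;
  ks_k4 : forall x y, f 1%N x y * f 4%N x y = (m - r ^+ 2 + 1) * f 3%N x y }.

Section KreinSystem.
Context {R : realFieldType} {T : finType} {m r : R} {f : nat -> T -> T -> R}.
Context (hf : krein_system m r f).

Context {c : T -> T -> R} (cE : forall x y, c x y = r / m * f 1%N x y).

Let m0 : m != 0 := ks_m0 hf.
Let r0 : r != 0 := ks_r0 hf.
Let g1 : r ^+ 2 - 1 != 0 := ks_g1 hf.

Lemma f1E x y : f 1%N x y = m / r * c x y.
Proof. by rewrite !cE; field; rewrite ?m0 ?r0 ?g1. Qed.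

(** [ks_k1], [ks_k2] and [ks_k3] are solved in turn, which makes [f 2], [f 3] and [f 4] polynomials
    in [c] of degrees 2, 3 and 4. *)
Lemma f2E x y : f 2%N x y = m * c x y ^+ 2 - r ^+ 2.
Proof.
have := ks_k1 hf x y; rewrite f1E => h.
have -> : f 2%N x y = r ^+ 2 / m * (m + m / r ^+ 2 * f 2%N x y - m).
  by field; rewrite ?m0 ?r0 ?g1.
by rewrite -h; field; rewrite ?m0 ?r0 ?g1.
Qed.

Lemma f3E x y :
  f 3%N x y = m / r * c x y * (m * c x y ^+ 2 - r ^+ 2 - m + 1) / (r ^+ 2 - 1).
Proof.
have := ks_k2 hf x y; rewrite f1E f2E => h.
apply: (mulfI g1); apply: (addrI ((m - 1) * (m / r * c x y))).
by rewrite -h; field; rewrite ?m0 ?r0 ?g1.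
Qed.

Lemma f4E x y : f 4%N x y
  = c x y / r * f 3%N x y - (r ^+ 2 - 1) / r ^+ 2 * f 2%N x y.
Proof.
have := ks_k3 hf x y; rewrite f1E => h.
apply: (mulfI m0).
apply: (addrI (m * (r ^+ 2 - 1) / r ^+ 2 * f 2%N x y)); rewrite -h.
by field; rewrite ?m0 ?r0 ?g1.
Qed.

(** [ks_k4] closes the recursion: after substitution it is an equation of degree 5 in [c x y], and
    it factors completely. *)
Lemma c_root x y : c x y * (c x y ^+ 2 - 1) * (c x y ^+ 2 - r ^+ 2) = 0.
Proof.
have := ks_k4 hf x y; rewrite f4E f1E f2E f3E => /eqP; rewrite -subr_eq0.
(* The quintic is the claimed product times [m ^ 3 / ((r ^ 2 - 1) * r ^ 3)]. *)
move=> /eqP h; apply: (mulfI m0); apply: (mulfI m0); apply: (mulfI m0).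
rewrite !mulr0 -[RHS](mulr0 ((r ^+ 2 - 1) * r ^+ 3)) -h.
by field; rewrite ?m0 ?r0 ?g1.
Qed.

Lemma c_sym x y : c x y = c y x. Proof. by rewrite !cE (ks_sym hf). Qed.

Lemma cxx x : c x x = r. Proof. by rewrite !cE (ks_diag hf);
  field; rewrite ?m0 ?r0 ?g1. Qed.

(** Where [c x y = r], the five [f i x y] add up to [2 * m ^ 2], which is nonzero, whereas [ks_sum]
    gives 0 off the diagonal. *)
Lemma cP x y : c x y = r -> x = y.
Proof.
move=> h; have := ks_sum hf x y.
rewrite f4E f3E f2E f1E h (ks_f0 hf); case: eqP => // _.
rewrite mulr0 => /eqP; have -> : 1 + m / r * r + (m * r ^+ 2 - r ^+ 2) +
  m / r * r * (m * r ^+ 2 - r ^+ 2 - m + 1) / (r ^+ 2 - 1) +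
  (r / r * (m / r * r * (m * r ^+ 2 - r ^+ 2 - m + 1) / (r ^+ 2 - 1)) -
   (r ^+ 2 - 1) / r ^+ 2 * (m * r ^+ 2 - r ^+ 2)) = 2 * m ^+ 2.
  by field; rewrite ?m0 ?r0 ?g1.
by rewrite mulf_eq0 sqrf_eq0 (negPf m0) pnatr_eq0.
Qed.

Lemma cardT (x : T) : #|T|%:R = 2 * m ^+ 2.
Proof.
have := ks_sum hf x x.
rewrite f4E f3E f2E f1E cxx (ks_f0 hf) eqxx mulr1 => <-.
by field; rewrite ?m0 ?r0 ?g1.
Qed.

Lemma sum_cc x y : \sum_z c x z * c y z = 2 * m * r * c x y.
Proof.
transitivity (r / m * (r / m * (\sum_z f 1%N x z * f 1%N z y))).
  by rewrite !mulr_sumr; apply: eq_bigr => z _;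
    rewrite [f 1%N z y](ks_sym hf) !cE; ring.
by rewrite (ks_idem hf) (cardT x) !cE; field; rewrite ?m0 ?r0 ?g1.
Qed.

(** * Antipodal points *)

(* As unit vectors, [x] and [s] satisfy [|x + s|^2 = 0]. *)
Lemma c_antipode x s : c x s = - r -> forall y, c y s = - c y x.
Proof.
move=> h y; have /eqP : \sum_z (c x z + c s z) ^+ 2 = 0.
  transitivity (\sum_z (c x z * c x z + 2 * (c x z * c s z) + c s z * c s z)).
    by apply: eq_bigr => z _; ring.
  by rewrite !big_split /= -mulr_sumr !sum_cc !cxx h; ring.
rewrite psumr_eq0 => [/allP/(_ y (mem_index_enum _))|? _]; last exact: sqr_ge0.
rewrite /= sqrf_eq0 addr_eq0 => /eqP e.
by rewrite ![c y _]c_sym e opprK.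
Qed.

Lemma antipode_neq x s : c x s = - r -> s != x.
Proof.
move=> xs; apply/eqP => e; move: xs; rewrite e cxx => /eqP.
by rewrite -subr_eq0 opprK -mulr2n mulrn_eq0 (negPf r0).
Qed.

Lemma sum_f i x : (0 < i < 5)%N -> \sum_y f i x y = 0.
Proof.
case/andP=> i0 i5.
transitivity (\sum_y f i x y * f 0%N y x); last by rewrite (ks_orth hf) -?lt0n.
by apply: eq_bigr => y _; rewrite (ks_f0 hf) mulr1.
Qed.

Lemma sum_c x : \sum_y c x y = 0.
Proof. by under eq_bigr do rewrite cE; rewrite -mulr_sumr sum_f // mulr0. Qed.

(** The row sums of [c ^ 3 - c] vanish, since it is a combination of [f 1] and [f 3]. Without an
    antipode only [y = x] would contribute, and it gives [r ^ 3 - r], which is nonzero. *)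
Lemma exists_antipode x : exists s, c x s = - r.
Proof.
suff /existsP[s /eqP xs] : [exists s, c x s == - r] by exists s.
apply: contraT => /existsPn ns.
have /eqP : \sum_y (c x y ^+ 3 - c x y) = 0.
  (* The coefficients come from expanding the entrywise cube of [f 1] by [ks_k1] and then
     [ks_k2]. *)
  transitivity (\sum_y ((r ^+ 2 / m ^+ 2 * (m + (m / r ^+ 2) * (m - 1)) - 1) * c x y
     + r / m ^+ 2 * (r ^+ 2 - 1) * f 3%N x y)).
    apply: eq_bigr => y _; rewrite f3E; field; rewrite ?m0 ?r0 ?g1; exact: isT.
  by rewrite big_split -!mulr_sumr sum_c sum_f //= !mulr0 addr0.
rewrite (bigD1 x) //= cxx big1 ?addr0 => [|y yx].
  have -> : r ^+ 3 - r = r * (r ^+ 2 - 1) by ring.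
  by rewrite mulf_eq0 (negPf r0) (negPf g1).
have /eqP := c_root x y; rewrite mulf_eq0 => /orP[/eqP e|].
  by rewrite -[RHS]e; ring.
rewrite subr_eq0 eqf_sqr (negPf (ns y)) orbF => /eqP /cP e.
by rewrite e eqxx in yx.
Qed.

(** * Triple sums over the points *)

(** The existential hypothesis encodes that [f k] is absent from the entrywise product of [f i] and
    [f j]; by [ks_orth] the full entrywise product of the three then has total sum 0. *)
Lemma sum_fff_eq0 i j k : (k < 5)%N ->
  (exists a b u v, [/\ (u < 5)%N, (v < 5)%N, u != k, v != k &
     forall x y, f i x y * f j x y = a * f u x y + b * f v x y]) ->
  forall x y z, \sum_t f i x t * f j y t * f k z t = 0.
Proof.
move=> k5 [a [b [u [v [u5 v5 uk vk e]]]]].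
have idem l x y : \sum_z f l z x * f l z y = #|T|%:R * f l x y.
  by rewrite -(ks_idem hf); apply: eq_bigr => z _; rewrite [f l z x](ks_sym hf).
apply: (triple_sum_eq0 (a := #|T|%:R)) => // {idem}.
apply: big1 => x _.
transitivity (\sum_y (a * (f u x y * f k y x) + b * (f v x y * f k y x))).
  by apply: eq_bigr => y _; rewrite e [f k y x](ks_sym hf); ring.
by rewrite big_split -!mulr_sumr /= !(ks_orth hf) // !mulr0 addr0.
Qed.

Lemma sum_f1f1f1 x y z : \sum_t f 1%N x t * f 1%N y t * f 1%N z t = 0.
Proof.
apply: sum_fff_eq0 => //; exists m, (m / r ^+ 2), 0%N, 2%N; split=> // u v.
by rewrite (ks_k1 hf) (ks_f0 hf) mulr1.
Qed.

Lemma sum_f1f1f4 x y z : \sum_t f 1%N x t * f 1%N y t * f 4%N z t = 0.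
Proof.
apply: sum_fff_eq0 => //; exists m, (m / r ^+ 2), 0%N, 2%N; split=> // u v.
by rewrite (ks_k1 hf) (ks_f0 hf) mulr1.
Qed.

Lemma sum_f1f2f2 x y z : \sum_t f 1%N x t * f 2%N y t * f 2%N z t = 0.
Proof.
apply: sum_fff_eq0 => //; exists (m - 1), (r ^+ 2 - 1), 1%N, 3%N;
  split=> // u v.
exact: (ks_k2 hf).
Qed.

Lemma sum_ccc x y z : \sum_t c x t * c y t * c z t = 0.
Proof.
transitivity ((r / m) ^+ 3 * (\sum_t f 1%N x t * f 1%N y t * f 1%N z t)).
  by rewrite mulr_sumr; apply: eq_bigr => t _; rewrite !cE; ring.
by rewrite sum_f1f1f1 mulr0.
Qed.

(** As [c ^ 2] is affine in [f 2], the product expands into one triple sum of type (1,2,2), two sums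
    killed by orthogonality, and a row sum of [c]. *)
Lemma sum_c2cc2 x y z : \sum_t c x t ^+ 2 * c y t * c z t ^+ 2 = 0.
Proof.
transitivity (\sum_t (r ^+ 4 / m ^+ 2 * c y t
   + r ^+ 3 / m ^+ 3 * (f 2%N x t * f 1%N t y)
   + r ^+ 3 / m ^+ 3 * (f 2%N z t * f 1%N t y)
   + r / m ^+ 3 * (f 1%N y t * f 2%N x t * f 2%N z t))).
  by apply: eq_bigr => t _; rewrite ![f 1%N _ y](ks_sym hf) f1E !f2E;
    field; rewrite ?m0 ?r0 ?g1.
rewrite !big_split -!mulr_sumr /= sum_f1f2f2 !(ks_orth hf) // sum_c.
by rewrite !mulr0 !addr0.
Qed.

(** The quartic for [f 4] agrees with [r ^ 2 - 1 - m * c ^ 2] at 0, 1 and -1, and exceeds it by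
    [m ^ 2] at [r] and [- r], values taken only at [x] and [s]. *)
Lemma f4_antipode x s y : c x s = - r ->
  f 4%N x y = r ^+ 2 - 1 - m * c x y ^+ 2
    + m ^+ 2 * ((y == x)%:R + (y == s)%:R).
Proof.
move=> xs; have sx := antipode_neq xs.
rewrite f4E f3E f2E; have [->|yx] := eqVneq y x.
  by rewrite cxx eq_sym (negPf sx) /= mulr1n mulr0n; field; rewrite ?m0 ?r0 ?g1.
have [->|ys] := eqVneq y s.
  by rewrite xs /= mulr1n mulr0n; field; rewrite ?m0 ?r0 ?g1.
have /eqP := c_root x y; rewrite -mulrA mulf_eq0 => /orP[/eqP ->|].
  by rewrite /= mulr0n; field; rewrite ?m0 ?r0 ?g1.
rewrite mulf_eq0 subr_eq0 subr_eq0 eqf_sqr orbC => /orP[/orP[]/eqP e|/eqP e].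
- by rewrite (cP e) eqxx in yx.
- have h : c s y = r by rewrite (c_antipode e s) c_sym xs opprK.
  by rewrite (cP h) eqxx in ys.
(* Only even powers of [c x y] occur, so [e] settles both signs at once. *)
transitivity ((m * c x y ^+ 2 - r ^+ 2 - m + 1) * m * c x y ^+ 2 / r ^+ 2 / (r ^+ 2 - 1)
   - (r ^+ 2 - 1) / r ^+ 2 * (m * c x y ^+ 2 - r ^+ 2)).
  by field; rewrite ?m0 ?r0 ?g1.
by rewrite e /= mulr0n; field; rewrite ?m0 ?r0 ?g1.
Qed.

(** [f4_antipode] is solved for [m * c ^ 2]: the [f 4] part drops out by [sum_f1f1f4], the constant
    part is [sum_cc], and [x] and its antipode contribute equally because two signs cancel. *)
Lemma sum_c2cc x y z :
  \sum_t c x t ^+ 2 * c y t * c z t =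
  2 * ((r ^+ 2 - 1) * r * c y z + m * (c x y * c x z)).
Proof.
have [s xs] := exists_antipode x.
have ys : c y s = - c y x := c_antipode xs y.
have zs : c z s = - c z x := c_antipode xs z.
apply: (mulfI m0); rewrite mulr_sumr.
transitivity (\sum_t ((r ^+ 2 - 1) * (c y t * c z t)
   + m ^+ 2 * (c y t * c z t * (t == x)%:R)
   + m ^+ 2 * (c y t * c z t * (t == s)%:R)
   - r ^+ 2 / m ^+ 2 * (f 1%N y t * f 1%N z t * f 4%N x t))).
  apply: eq_bigr => t _; rewrite (f4_antipode t xs) !f1E.
  by field; rewrite ?m0 ?r0 ?g1.
have pick (h : T -> R) u : \sum_t h t * (t == u)%:R = h u.
  rewrite (bigD1 u) //= eqxx mulr1 big1 ?addr0 // => t /negPf ->.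
  by rewrite mulr0.
rewrite big_split sumrN !big_split /= -!mulr_sumr sum_f1f1f4 !pick sum_cc.
by rewrite ys zs [c y x]c_sym [c z x]c_sym; ring.
Qed.

(** * Finding the three points *)

(** If [c] had no zero in the row of [x], then [c ^ 2 - 1] would live on [x] and its antipode only.
    Comparing the two values of its row sum contradicts [m - 1] and [m - r ^ 2 + 1] being
    nonzero. *)
Lemma exists_orthogonal (x : T) : exists y, c x y = 0.
Proof.
suff /existsP[y /eqP xy] : [exists y, c x y == 0] by exists y.
apply: contraT => /existsPn nz.
have [s xs] := exists_antipode x.
have sx := antipode_neq xs.
have /eqP : \sum_y (c x y * c x y - 1) = 2 * (r ^+ 2 - 1).
  rewrite (bigD1 x) //= (bigD1 s) //= big1 ?addr0 => [|y /andP[yx ys]].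
    by rewrite cxx xs; ring.
  have /eqP := c_root x y; rewrite !mulf_eq0 (negPf (nz y))
    /= => /orP[/eqP //|].
  rewrite subr_eq0 eqf_sqr => /orP[]/eqP e.
    by rewrite (cP e) eqxx in yx.
  have h : c s y = r by rewrite (c_antipode e s) c_sym xs opprK.
  by rewrite (cP h) eqxx in ys.
rewrite big_split /= sum_cc sumrN sumr_const cardT // cxx -subr_eq0.
have -> : 2 * m * r * r - 2 * m ^+ 2 - 2 * (r ^+ 2 - 1) =
  - (2 * (m - 1) * (m - r ^+ 2 + 1)) by ring.
by rewrite oppr_eq0 !mulf_eq0 pnatr_eq0 (negPf (ks_m1 hf)) (negPf (ks_gm hf)).
Qed.

(** The sum of [c y x ^ 2 * c z x ^ 2] over [x] is nonzero, so some [x] is orthogonal to neither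
    point. *)
Lemma exists_common_neighbour y z : c y z = 0 ->
  exists x, c x y ^+ 2 = 1 /\ c x z ^+ 2 = 1.
Proof.
move=> yz.
have sum_ne0 : \sum_x c y x ^+ 2 * c z x ^+ 2 != 0.
  suff -> : \sum_x c y x ^+ 2 * c z x ^+ 2 = 2 * r ^+ 2 * (r ^+ 2 - 1).
    by rewrite !mulf_neq0 // pnatr_eq0.
  transitivity (\sum_x (r ^+ 4 / m ^+ 2 + r ^+ 2 / m ^+ 2 * f 2%N y x
     + r ^+ 2 / m ^+ 2 * f 2%N z x + (m ^+ 2)^-1 * (f 2%N y x * f 2%N x z))).
    by apply: eq_bigr => x _; rewrite ![f 2%N x _](ks_sym hf) !f2E;
      field; rewrite ?m0 ?r0 ?g1.
  rewrite !big_split -!mulr_sumr /= !sum_f // (ks_idem hf) sumr_const.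
  by rewrite -[_ *+ #|_|]mulr_natr (cardT y) f2E yz; field; rewrite ?m0 ?r0 ?g1.
have [/existsP[x /andP[y1 z1]]|/existsPn no] :=
    boolP [exists x, (c y x != 0) && (c z x != 0)]; last first.
  case/eqP: sum_ne0; apply: big1 => x _; have := no x.
  by rewrite negb_and !negbK => /orP[]/eqP ->; rewrite expr0n ?mul0r ?mulr0.
(* If [c u x] were [r] or [- r], then [x] would be [u] or its antipode, hence orthogonal to [v]. *)
have unit u v : c u x != 0 -> c v x != 0 -> c v u = 0 -> c u x ^+ 2 = 1.
  move=> ux vx vu; have /eqP := c_root u x.
  rewrite !mulf_eq0 (negPf ux) /= => /orP[|].
    by rewrite subr_eq0 => /eqP.
  rewrite subr_eq0 eqf_sqr => /orP[]/eqP e.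
    by rewrite -(cP e) vu eqxx in vx.
  by rewrite (c_antipode e) vu oppr0 eqxx in vx.
exists x; rewrite ![c x _]c_sym; split.
  by apply: (unit y z) => //; rewrite c_sym.
exact: (unit z y).
Qed.

End KreinSystem.

(** * Divisibility by 4 and the parity of [m] *)

Lemma dvdz_sqrD (a : int) : (2 %| a ^+ 2 + a)%Z.
Proof.
rewrite (_ : a ^+ 2 + a = a * (a + 1)); last by ring.
have : (2 %| a)%Z \/ (2 %| a + 1)%Z by lia.
by case=> h; [exact: dvdz_mulr | exact: dvdz_mull].
Qed.

Lemma dvdz_sqrB (a : int) : (2 %| a ^+ 2 - a)%Z.
Proof. by rewrite -sqrrN dvdz_sqrD. Qed.

Lemma krein_system_even (R : realFieldType) (T : finType) (m r : int)
    (f : nat -> T -> T -> R) (x0 : T) :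
  krein_system m%:~R r%:~R f -> (2 %| m)%Z.
Proof.
move=> hf.
have [c cE] : exists c : T -> T -> R,
    forall x y, c x y = r%:~R / m%:~R * f 1%N x y.
  by exists (fun x y => r%:~R / m%:~R * f 1%N x y).
have [C Cc] : exists C : T -> T -> int, forall x y, c x y = (C x y)%:~R.
  have ex (p : T * T) : exists k : int, c p.1 p.2 == k%:~R.
    have /eqP := c_root hf cE p.1 p.2.
    rewrite !mulf_eq0 !subr_eq0 sqrf_eq1 eqf_sqr -!orbA.
    case/or4P=> [/eqP ->|/eqP ->|/eqP ->|/orP[/eqP ->|/eqP ->]].
    - by exists 0.
    - by exists 1.
    - by exists (- 1); rewrite mulrNz.
    - by exists r.
    - by exists (- r); rewrite mulrNz.
  by exists (fun x y => xchoose (ex (x, y)))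
    => x y; apply/eqP/(xchooseP (ex (x, y))).
have [z0 yz] := exists_orthogonal hf cE x0.
move: x0 z0 yz => y z yz.
have [x [xy xz]] := exists_common_neighbour hf cE yz.
have e1 : \sum_t C x t ^+ 2 * C y t * C z t = 2 * (m * (C x y * C x z)).
  apply: (@intr_inj R); rewrite rmorph_sum /=.
  transitivity (\sum_t c x t ^+ 2 * c y t * c z t).
    by apply: eq_bigr => t _; rewrite !Cc; ring.
  by rewrite (sum_c2cc hf cE) yz mulr0 add0r !Cc; ring.
(* With [z] as the squared point, [c z y = 0] removes the term in [m]. *)
have e2 : \sum_t C z t ^+ 2 * C x t * C y t = 2 * ((r ^+ 2 - 1) * r * C x y).
  apply: (@intr_inj R); rewrite rmorph_sum /=.
  transitivity (\sum_t c z t ^+ 2 * c x t * c y t).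
    by apply: eq_bigr => t _; rewrite !Cc; ring.
  rewrite (sum_c2cc hf cE) [c z y](c_sym hf cE) yz !mulr0 addr0 !Cc.
  by ring.
have e3 : \sum_t C x t * C y t * C z t = 0.
  apply: (@intr_inj R); rewrite rmorph_sum /= -[RHS](sum_ccc hf cE x y z).
  by apply: eq_bigr => t _; rewrite !Cc; ring.
have e4 : \sum_t C x t ^+ 2 * C y t * C z t ^+ 2 = 0.
  apply: (@intr_inj R); rewrite rmorph_sum /= -[RHS](sum_c2cc2 hf cE x y z).
  by apply: eq_bigr => t _; rewrite !Cc; ring.
have : (4 %| \sum_t (C x t ^+ 2 + C x t) * C y t * (C z t ^+ 2 - C z t))%Z.
  apply: rpred_sum => t _.
  rewrite mulrAC dvdz_mulr // (_ : 4 = 2 * 2) //.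
  by apply: dvdz_mul; [exact: dvdz_sqrD|exact: dvdz_sqrB].
have -> : \sum_t (C x t ^+ 2 + C x t) * C y t * (C z t ^+ 2 - C z t) =
  2 * ((r ^+ 2 - 1) * r * C x y - m * (C x y * C x z)).
  transitivity (\sum_t (C x t ^+ 2 * C y t * C z t ^+ 2
     - C x t ^+ 2 * C y t * C z t + C z t ^+ 2 * C x t * C y t
     - C x t * C y t * C z t)).
    by apply: eq_bigr => t _; ring.
  by rewrite !big_split /= !sumrN e1 e2 e3 e4; ring.
rewrite (_ : 4 = 2 * 2) // dvdz_mul2l // => h2.
have r2 : (2 %| (r ^+ 2 - 1) * r * C x y)%Z.
  apply: dvdz_mulr; have : (2 %| r)%Z \/ (2 %| r + 1)%Z by lia.
  rewrite (_ : r ^+ 2 - 1 = (r + 1) * (r - 1)); last by ring.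
  by case=> h; [apply: dvdz_mull|rewrite -mulrA; apply: dvdz_mulr].
have sq1 k : (k%:~R : R) ^+ 2 = 1 -> k ^+ 2 = 1 :> int.
  by move=> h; apply: (@intr_inj R); rewrite rmorphXn.
rewrite !Cc in xy xz.
(* Both entries square to 1, so [m] is a multiple of [m * (C x y * C x z)], which is even. *)
rewrite (_ : m = m * (C x y * C x z) * (C x y * C x z)); last first.
  transitivity (m * (C x y ^+ 2 * C x z ^+ 2)); last by ring.
  by rewrite !sq1 // !mulr1.
apply: dvdz_mulr; have := rpredB r2 h2.
by rewrite opprB addrC subrK.
Qed.

(** * The Bose-Mesner algebra and its Krein parameters *)

Lemma memv_span_map (K : fieldType) (vT : vectType K) (I : finType)
    (v : I -> vT) (u : vT) :
  u \in <<[seq v i | i <- enum I]>>%VS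
    -> exists a : I -> K, u = \sum_i a i *: v i.
Proof.
rewrite span_def big_map big_enum /= => /memv_sumP[w hw ->].
have ex i : exists k, w i == k *: v i.
  by have /vlineP[k ->] := hw i isT; exists k.
exists (fun i => xchoose (ex i)); apply: eq_bigr => i _.
by apply/eqP/(xchooseP (ex i)).
Qed.

Section BoseMesner.
Context {R : realType} {X : finType} {D : nat} {S : 'I_D.+1 -> {set X * X}}.
Context (hS : assoc_scheme R S).

Let V := bose_mesner R S.

Lemma adjmx_bose_mesner i : adjmx R (S i) \in V.
Proof. by apply: memv_span; apply: map_f; rewrite mem_enum. Qed.

Lemma bose_mesner_sym F : F \in V -> F^T = F.
Proof.
case: hS => _ _ _ hsym _ /memv_span_map[a ->].
by rewrite linear_sum; apply: eq_bigr => i _ /=; rewrite linearZ /= hsym.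
Qed.

Lemma bose_mesner_mul F G : F \in V -> G \in V -> F *m G \in V.
Proof.
case: hS => _ _ _ _ [p hp] /memv_span_map[a ->] /memv_span_map[b ->].
rewrite mulmx_suml memv_suml // => i _.
rewrite mulmx_sumr memv_suml // => j _.
rewrite -scalemxAl -scalemxAr !memvZ // hp memv_suml // => k _.
by rewrite memvZ // adjmx_bose_mesner.
Qed.

(** Every element of the algebra is symmetric, products included, and transposition reverses a
    product. *)
Lemma bose_mesner_comm F G : F \in V -> G \in V -> F *m G = G *m F.
Proof.
move=> hF hG; rewrite -(bose_mesner_sym (bose_mesner_mul hF hG)) trmx_mul.
by rewrite !bose_mesner_sym.
Qed.

(** By commutativity [A *m B] and [A - A *m B] are orthogonal idempotents with sum [A], so one of
    them is 0. If [F *m G] were nonzero, it would equal both [F] and [G]. *)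
Lemma primitive_idempotent_orth F G :
  primitive_idempotent V F -> primitive_idempotent V G -> F != G -> F *m G = 0.
Proof.
move=> pF pG /eqP FG.
have half A B : primitive_idempotent V A -> primitive_idempotent V B ->
    A *m B = 0 \/ A *m B = A.
  move=> [[VA AA] _ pA] [[VB BB] _ _].
  have AB := bose_mesner_comm VA VB.
  have idem : A *m B *m (A *m B) = A *m B.
    by rewrite {1}AB mulmxA -(mulmxA B) AA -AB -mulmxA BB.
  have l : A *m (A *m B) = A *m B by rewrite mulmxA AA.
  have r : A *m B *m A = A *m B by rewrite -mulmxA -AB l.
  have [||||//|h|h] := pA (A *m B) (A - A *m B); last 2 first.
  - by left.
  - by right; apply/esym/eqP; rewrite -subr_eq0 h.
  - by split; [exact: bose_mesner_mul|].
  - split; first by rewrite rpredB // bose_mesner_mul.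
    by rewrite mulmxBl !mulmxBr AA idem l r subrr subr0.
  - by rewrite mulmxBr r idem subrr.
  - by rewrite mulmxBl l idem subrr.
  - by rewrite addrC subrK.
have [//|e1] := half F G pF pG.
have VF : F \in V by case: pF => -[].
have VG : G \in V by case: pG => -[].
have [|e2] := half G F pG pF; first by rewrite bose_mesner_comm.
by case: FG; rewrite -e1 bose_mesner_comm.
Qed.

Context {E : 'I_D.+1 -> 'M[R]_#|X|} (hE : primitive_idempotent_basis S E).

Lemma basis_in i : E i \in V.
Proof. by case: hE => _ /(_ i)[[]]. Qed.

Lemma basis_mul i j : E i *m E j = if i == j then E i else 0.
Proof.
case: hE => _ prim basis; have [->|ij] := eqVneq i j.
  by case: (prim j) => -[].
apply: primitive_idempotent_orth => //; apply: contra_neq ij => Eij.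
have /injectiveP inj : injectiveb E := free_uniq (basis_free basis).
exact: inj.
Qed.

Lemma basis_coef (a b : 'I_D.+1 -> R) :
  \sum_i a i *: E i = \sum_i b i *: E i -> a =1 b.
Proof.
move=> e i; have : (\sum_i a i *: E i) *m E i = (\sum_i b i *: E i) *m E i
  by rewrite e.
have pick (d : 'I_D.+1 -> R) : (\sum_i d i *: E i) *m E i = d i *: E i.
  rewrite mulmx_suml (bigD1 i) //= -scalemxAl basis_mul eqxx big1 ?addr0 //.
  by move=> j /negPf ji; rewrite -scalemxAl basis_mul ji scaler0.
have [_ /(_ i)[_ Ei0 _] _] := hE.
rewrite !pick => /eqP; rewrite -subr_eq0 -scalerBl scaler_eq0 (negPf Ei0) orbF.
by rewrite subr_eq0 => /eqP.
Qed.

(** The identity is [A_0], so it lies in the algebra; multiplying its expansion by [E i] forces each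
    coefficient to be 1. *)
Lemma basis_sum1 : \sum_i E i = 1%:M.
Proof.
have [_ A0 _ _ _] := hS.
have : (1%:M : 'M[R]_#|X|) \in V by rewrite -A0 adjmx_bose_mesner.
have [_ prim basis] := hE.
rewrite /V -(span_basis basis) => /memv_span_map[a e].
rewrite e; apply: eq_bigr => i _.
suff -> : a i = 1 by rewrite scale1r.
have : E i = a i *: E i.
  rewrite -{1}[E i]mul1mx e mulmx_suml (bigD1 i) //= -scalemxAl basis_mul eqxx.
  rewrite big1 ?addr0 // => j /negPf ji.
  by rewrite -scalemxAl basis_mul ji scaler0.
have [_ Ei0 _] := prim i.
move/eqP; rewrite -subr_eq0 -{1}[E i]scale1r -scalerBl scaler_eq0
  (negPf Ei0) orbF.
by rewrite subr_eq0 => /eqP.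
Qed.

Context {q : 'I_D.+1 -> 'I_D.+1 -> 'I_D.+1 -> R} (hq : krein_parameters E q).
Context (X0 : #|X|%:R != 0 :> R).

Lemma krein0 i k : q i ord0 k = (i == k)%:R.
Proof.
have [E0 _ _] := hE.
apply: (basis_coef (a := fun k => q i ord0 k) (b := fun k => (i == k)%:R)).
apply: (scalerI (invr_neq0 X0)); rewrite -hq E0.
rewrite (bigD1 i) //= eqxx scale1r big1 ?addr0; last first.
  by move=> j /negPf ij; rewrite eq_sym ij scale0r.
by apply/matrixP => x y; rewrite !mxE mulr1 mulrC.
Qed.

Lemma hadamard1E i :
  hadamard (E i) 1%:M = #|X|%:R^-1 *: \sum_k (\sum_j q i j k) *: E k.
Proof.
rewrite -basis_sum1; transitivity (\sum_j hadamard (E i) (E j)).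
  apply/matrixP => x y; rewrite !mxE !summxE mulr_sumr.
  by apply: eq_bigr => j _; rewrite mxE.
under eq_bigr do rewrite hq.
rewrite -scaler_sumr exchange_big /=; congr (_ *: _).
by apply: eq_bigr => k _; rewrite scaler_suml.
Qed.

Lemma basis_row_sum k x : \sum_y E k x y = (k == ord0)%:R.
Proof.
have [E0 _ _] := hE.
apply: (mulfI (invr_neq0 X0)).
transitivity ((E k *m E ord0) x x).
  rewrite E0 -scalemxAr !mxE; congr (_ * _).
  by apply: eq_bigr => y _; rewrite mxE mulr1.
by rewrite basis_mul; case: eqP => [->|_]; rewrite ?E0 !mxE ?mulr0.
Qed.

(** Row [x] of the entrywise product of [E i] with the identity is summed in two ways; among the
    [E k], only [E ord0] has nonzero row sums. *)
Lemma basis_diag i x : #|X|%:R * E i x x = \sum_j q i j ord0.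
Proof.
transitivity (#|X|%:R * \sum_y hadamard (E i) 1%:M x y).
  rewrite (bigD1 x) //= big1 ?addr0; first by rewrite !mxE eqxx mulr1.
  by move=> y /negPf yx; rewrite !mxE eq_sym yx mulr0.
rewrite hadamard1E; under eq_bigr do rewrite mxE summxE.
rewrite -mulr_sumr mulVKf // exchange_big /=.
have row k : \sum_y ((\sum_j q i j k) *: E k) x y =
    (\sum_j q i j k) * (k == ord0)%:R.
  by under eq_bigr do rewrite mxE; rewrite -mulr_sumr basis_row_sum.
rewrite (eq_bigr _ (fun k _ => row k)) (bigD1 ord0) //= mulr1
  [X in _ + X]big1 ?addr0 //.
by move=> k /negPf ->; rewrite mulr0.
Qed.

(** [E i] has constant diagonal, so its entrywise product with the identity is a multiple of the
    identity, that is, of the sum of all [E k]. *)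
Lemma krein_sum i k : \sum_j q i j k = \sum_j q i j ord0.
Proof.
apply: (basis_coef (a := fun k => \sum_j q i j k)
  (b := fun k => \sum_j q i j ord0)).
rewrite -scaler_sumr basis_sum1; apply: (scalerI (invr_neq0 X0)).
rewrite -hadamard1E; apply/matrixP => x y; rewrite !mxE.
have [<-|_] := eqVneq x y; last by rewrite !mulr0.
by rewrite -(basis_diag i x) !mulr1n !mulr1 mulKf.
Qed.

End BoseMesner.

(** * From a scheme with four classes to a Krein system *)

Lemma sum_inord5 (V : nmodType) (F : 'I_5 -> V) :
  \sum_i F i
    = F (inord 0) + F (inord 1) + F (inord 2) + F (inord 3) + F (inord 4).
Proof.
rewrite !big_ord_recr big_ord0 /= add0r.
by congr (F _ + F _ + F _ + F _ + F _); apply: val_inj; rewrite /= inordK.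
Qed.

Lemma scheme_krein_system (R : realType) (X : finType) (S : 'I_5 -> {set X * X})
    (m r : R) : r != 0 ->
  Qpolynomial_scheme S
    ([:: m; m - 1; m * (r ^+ 2 - 1) / r ^+ 2; m - r ^+ 2 + 1],
     [:: 1; m / r ^+ 2; r ^+ 2 - 1; m]) ->
  exists (_ : 'I_#|X|) (f : nat -> 'I_#|X| -> 'I_#|X| -> R), krein_system m r f.
Proof.
move=> r0 [hS [E [q [hE hq [_ tri] [b0 b1 b2 b3 c1 c2 c3 c4]]]]].
have [x0] : exists x : X, true.
  by have [/(_ ord0) + _ _ _ _] := hS; case/set0Pn => -[x _] _; exists x.
move=> _.
have X0 : #|X|%:R != 0 :> R
  by rewrite pnatr_eq0 -lt0n; apply/card_gt0P; exists x0.
have i0 : inord 0 = ord0 :> 'I_5 by apply: val_inj; rewrite /= inordK.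
have tri0 i j : [&& i < 5, j < 5 & (i.+1 < j) || (j.+1 < i)]%N ->
    q (inord 1) (inord j) (inord i) = 0.
  move=> /and3P[i5 j5 /orP ij]; have [+ _] := tri (inord i) (inord j).
  by rewrite mxE !inordK //; apply.
have triN0 i j : [&& i < 5, j < 5 & (i.+1 == j) || (j.+1 == i)]%N ->
    q (inord 1) (inord j) (inord i) != 0.
  move=> /and3P[i5 j5 /orP ij]; have [_] := tri (inord i) (inord j).
  by rewrite mxE !inordK //; apply; case: ij => /eqP ->; [left|right].
have q00 : q (inord 1) (inord 0) (inord 0) = 0.
  by rewrite i0 (krein0 hS hE hq X0) -val_eqE /= inordK.
have sum0 : \sum_j q (inord 1) j ord0 = m.
  by rewrite sum_inord5 -i0 q00 b0 !tri0 // !addr0 add0r.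
have sumq k := etrans (krein_sum hS hE hq X0 (inord 1) k) sum0.
(* In each row the prescribed off-diagonal entries already add up to [m], which leaves 0 for the
   diagonal. *)
have a1 : q (inord 1) (inord 1) (inord 1) = 0.
  have := sumq (inord 1);
    rewrite sum_inord5 c1 b1 (tri0 1%N 3%N isT) (tri0 1%N 4%N isT)
    // !addr0 => h.
  apply: (addrI 1); apply: (addIr (m - 1)); rewrite h; ring.
have a2 : q (inord 1) (inord 2) (inord 2) = 0.
  have := sumq (inord 2);
    rewrite sum_inord5 c2 b2 (tri0 2%N 0%N isT) (tri0 2%N 4%N isT)
    // add0r addr0 => h.
  apply: (addrI (m / r ^+ 2)); apply: (addIr (m * (r ^+ 2 - 1) / r ^+ 2)).
  by rewrite h; field; rewrite r0.
have a3 : q (inord 1) (inord 3) (inord 3) = 0.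
  have := sumq (inord 3);
    rewrite sum_inord5 c3 b3 (tri0 3%N 0%N isT) (tri0 3%N 1%N isT)
    // !add0r => h.
  apply: (addrI (r ^+ 2 - 1)); apply: (addIr (m - r ^+ 2 + 1)); rewrite h; ring.
have a4 : q (inord 1) (inord 4) (inord 4) = 0.
  have := sumq (inord 4);
    rewrite sum_inord5 c4 (tri0 4%N 0%N isT) (tri0 4%N 1%N isT)
    (tri0 4%N 2%N isT) // !add0r => h.
  by apply: (addrI m); rewrite h addr0.
(* Beyond 4, [inord] falls back to index 0, so symmetry and idempotency hold for every natural
   index. *)
exists (enum_rank x0), (fun k x y => #|X|%:R * E (inord k) x y).
have krein j x y : #|X|%:R * E (inord 1) x y * (#|X|%:R * E j x y) =
    \sum_k q (inord 1) j k * (#|X|%:R * E k x y).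
  have := hq (inord 1) j => /matrixP/(_ x y); rewrite !mxE summxE => h.
  rewrite mulrACA h mulrA mulfK // mulr_sumr.
  by apply: eq_bigr => k _; rewrite mxE mulrCA.
have Esym i x y : E i x y = E i y x.
  by rewrite -[in LHS](bose_mesner_sym hS (basis_in hE i)) mxE.
have mulE i j x y : \sum_z #|X|%:R * E i x z * (#|X|%:R * E j z y) =
    #|X|%:R ^+ 2 * (if i == j then E i x y else 0).
  have := basis_mul hS hE i j => /matrixP/(_ x y).
  rewrite (fun_if (fun M : 'M[R]_#|X| => M x y))
    [in X in if _ then _ else X]mxE => <-.
  by rewrite mxE mulr_sumr; apply: eq_bigr => z _; ring.
have [E0 _ _] := hE.
split=> //.
- by rewrite -b0; exact: triN0.
- by rewrite -b1; exact: triN0.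
- by rewrite -c3; exact: triN0.
- by rewrite -b3; exact: triN0.
- by move=> x y; rewrite i0 E0 !mxE mulr1 mulfV.
- by move=> i x y; rewrite Esym.
- by move=> i x y; rewrite mulE eqxx card_ord mulrA.
- move=> i j i5 j5 ij x y; rewrite mulE ifN ?mulr0 //.
  by apply: contra_neq ij => /(congr1 val); rewrite /= !inordK.
- move=> x y; rewrite card_ord -!mulrDr; congr (_ * _).
  have := basis_sum1 hS hE => /matrixP/(_ x y).
  by rewrite sum_inord5 !mxE.
- by move=> x; rewrite (basis_diag hS hE hq X0) sum0.
- move=> x y;
    rewrite krein sum_inord5 b0 a1 c2 (tri0 3%N 1%N isT) (tri0 4%N 1%N isT)
    // !mul0r !addr0.
  by rewrite i0 E0 !mxE mulr1 mulfV // mulr1.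
- by move=> x y;
    rewrite krein sum_inord5 b1 a2 c3 (tri0 0%N 2%N isT) (tri0 4%N 2%N isT)
    // !mul0r !addr0 add0r.
- by move=> x y;
    rewrite krein sum_inord5 b2 a3 c4 (tri0 0%N 3%N isT) (tri0 1%N 3%N isT)
    // !mul0r !addr0 !add0r.
- by move=> x y;
    rewrite krein sum_inord5 b3 a4 (tri0 0%N 4%N isT) (tri0 1%N 4%N isT)
    (tri0 2%N 4%N isT) // !mul0r !addr0 !add0r.
Qed.

Theorem theorem4p9 (R : realType) (m r : int) (hr : r <> 0)
    (hm : ~~ (2 %| m)%Z) :
  ~ exists (X : finType) (D : nat) (S : 'I_D.+1 -> {set X * X}),
      @Qpolynomial_scheme R X D S
        ([:: m%:~R; m%:~R - 1;
             m%:~R * (r%:~R ^+ 2 - 1) / r%:~R ^+ 2;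
             m%:~R - r%:~R ^+ 2 + 1],
         [:: 1; m%:~R / r%:~R ^+ 2; r%:~R ^+ 2 - 1; m%:~R]).
Proof.
move=> [X [D [S hS]]].
(* The length of the Krein array determines the number of classes. *)
have D4 : D = 4%N.
  case: hS => _ [E [q [_ _ _ [/(congr1 size)]]]].
  by rewrite size_map size_iota.
subst D; have r0 : r%:~R != 0 :> R by rewrite intr_eq0; apply/eqP.
have [x [f hf]] := scheme_krein_system r0 hS.
by rewrite (krein_system_even x hf) in hm.
Qed.
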